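(* Let $(\overline{M},\overline{\nabla},g,J)$ be a holomorphic statistical manifold of real dimension $2m$, $m\geq 4$, whose statistical Bochner curvature tensor $\overline{\mathcal{B}}$ vanishes identically. Let $M$ be a doubly autoparallel Lagrangian statistical submanifold of $\overline{M}$. Then $M$ is conformally flat, i.e. the statistical Weyl curvature tensor $\mathcal{C}^s$ of $M$ (with its induced statistical structure) vanishes identically.
   Context: All manifolds, metrics and connections are smooth. Statistical manifold: a manifold $N$ with a Riemannian metric $g$ and a torsion-free affine connection $\nabla$ such that the $(0,3)$-tensor field $\nabla g$ is totally symmetric. The dual connection $\nabla^*$ is defined by $Xg(Y,Z)=g(\nabla_XY,Z)+g(Y,\nabla^*_XZ)$; it is also torsion-free. Statistical curvature: with $\mathcal{R}(X,Y)Z=\nabla_X\nabla_YZ-\nabla_Y\nabla_XZ-\nabla_{[X,Y]}Z$ and $\mathcal{R}^*$ the same expression for $\nabla^*$, set $\mathcal{S}(X,Y)Z=\frac12[\mathcal{R}(X,Y)Z+\mathcal{R}^*(X,Y)Z]$. The statistical Ricci curvature is $\mathcal{L}(Y,Z)=\operatorname{tr}\{X\mapsto \mathcal{S}(X,Y)Z\}$; the same letter denotes the $(1,1)$-tensor given by $g(\mathcal{L}Y,Z)=\mathcal{L}(Y,Z)$. The statistical scalar curvature is $\rho=\operatorname{tr}_g\mathcal{L}$. For $\overline{M}$ these objects are written $\overline{\mathcal{S}},\overline{\mathcal{L}},\overline{\rho}$. Holomorphic statistical manifold $(\overline{M},\overline{\nabla},g,J)$: an almost complex manifold with almost complex structure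 $J$ and a statistical structure $(\overline{\nabla},g)$ such that $\omega(X,Y)=g(X,JY)$ is a $\overline{\nabla}$-parallel 2-form (so $g$ is $J$-Hermitian). Statistical Bochner curvature tensor of a holomorphic statistical manifold of real dimension $2m$: $$\begin{aligned}\overline{\mathcal{B}}(X,Y)Z=\;&\overline{\mathcal{S}}(X,Y)Z-\tfrac{1}{2m+4}\{g(Y,Z)\overline{\mathcal{L}}X-g(\overline{\mathcal{L}}X,Z)Y+g(\overline{\mathcal{L}}Y,Z)X-g(X,Z)\overline{\mathcal{L}}Y\\&+g(JY,Z)\overline{\mathcal{L}}JX-g(\overline{\mathcal{L}}JX,Z)JY+g(\overline{\mathcal{L}}JY,Z)JX-g(JX,Z)\overline{\mathcal{L}}JY\\&-2g(JX,\overline{\mathcal{L}}Y)JZ-2g(JX,Y)\overline{\mathcal{L}}JZ\}\\&+\tfrac{\overline{\rho}}{(2m+4)(2m+2)}\{g(Y,Z)X-g(X,Z)Y+g(JY,Z)JX-g(JX,Z)JY-2g(JX,Y)JZ\}.\end{aligned}$$ Submanifolds: let $M$ be an isometrically immersed submanifold of $\overline{M}$ with induced metric $g$. For $X,Y$ tangent to $M$ decompose into tangential and normal parts $\overline{\nabla}_XY=\nabla_XY+h(X,Y)$ and $\overline{\nabla}^*_XY=\nabla^*_XY+h^*(X,Y)$. Then $(\nabla,g)$ is the induced statistical structure on $M$ (a statistical submanifold), with dual connection $\nabla^*$. $M$ is doubly autoparallel if $h=0$ and $h^*=0$. $M$ is Lagrangian if $J(T_xM)=(T_xM)^\perp$ for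 all $x\in M$ (so $\dim M=m$). Statistical Weyl curvature tensor of a statistical manifold of dimension $n\ge 3$ with statistical curvature $\mathcal{S}$, Ricci operator $\mathcal{L}$ and scalar curvature $\rho$: $$\mathcal{C}^s(X,Y)Z=\mathcal{S}(X,Y)Z-\tfrac{1}{n-2}[g(Y,Z)\mathcal{L}X-g(\mathcal{L}X,Z)Y+g(\mathcal{L}Y,Z)X-g(X,Z)\mathcal{L}Y]+\tfrac{\rho}{(n-2)(n-1)}[g(Y,Z)X-g(X,Z)Y].$$ For $M$ in the claim, $n=m$. *)

(* Defs.v *)
From mathcomp Require Import all_boot all_order all_algebra.
From mathcomp Require Import all_classical all_reals all_analysis.

Set Implicit Arguments.
Unset Strict Implicit.
Unset Printing Implicit Defensive.

Import Order.TTheory GRing.Theory Num.Theory.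
Import numFieldNormedType.Exports.

Local Open Scope classical_set_scope.
Local Open Scope ring_scope.

(* Manifolds are modelled on row vectors 'rV[R]_n.  Tensor fields and affine
   connections are families of local representatives, one for each chart,
   related by the usual transformation laws on overlaps.  A linear map with
   matrix A acts on tangent vectors by u |-> u *m A. *)

Fixpoint C_k (R : realType) (V W : normedModType R) (k : nat)
    (U : set V) (f : V -> W) : Prop :=
  match k with
  | 0 => forall x, U x -> {for x, continuous f}
  | k'.+1 => (forall x, U x -> differentiable f x) /\
             (forall v : V, C_k k' U ('D_v f))
  end.

Definition smooth (R : realType) (V W : normedModType R)
    (U : set V) (f : V -> W) : Prop := forall k, C_k k U f.

Record manifold (R : realType) (n : nat) := Manifold {
  points :> topologicalType;
  chart : Type;
  cdom : chart -> set points;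
  cmap : chart -> points -> 'rV[R]_n;
  cinv : chart -> 'rV[R]_n -> points;
  cdom_open : forall i, open (cdom i);
  cdom_cover : forall x, exists i, cdom i x;
  cimg_open : forall i, open (cmap i @` cdom i);
  cmapK : forall i x, cdom i x -> cinv i (cmap i x) = x;
  cmap_continuous : forall i x, cdom i x -> {for x, continuous (cmap i)};
  cinv_continuous : forall i y, (cmap i @` cdom i) y ->
    {for y, continuous (cinv i)};
  transition_smooth : forall i j,
    smooth ((cmap i @` cdom i) `&` cinv i @^-1` cdom j) (cmap j \o cinv i);
  points_hausdorff : hausdorff_space points;
  points_second_countable : @second_countable points
}.

Definition cimg (R : realType) (n : nat) (M : manifold R n) (i : chart M) :
  set 'rV[R]_n := cmap i @` cdom i.

Definition overlap (R : realType) (n : nat) (M : manifold R n)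
  (i j : chart M) : set 'rV[R]_n := cimg i `&` cinv i @^-1` cdom j.

Definition transition (R : realType) (n : nat) (M : manifold R n)
  (i j : chart M) : 'rV[R]_n -> 'rV[R]_n := cmap j \o cinv i.

Section LocalCalculus.
Context {R : realType} {n : nat}.
Implicit Types (G : 'rV[R]_n -> 'M[R]_n) (Gam : 'rV[R]_n -> 'I_n -> 'M[R]_n).
Implicit Types (X Y Z : 'rV[R]_n -> 'rV[R]_n) (y u v w : 'rV[R]_n).

(* The value on (u, v) of the (0,2)-tensor with Gram matrix G y. *)
Definition form G y u v : R := (u *m G y *m v^T) 0 0.

(* Gam y k i j is the Christoffel symbol Gamma^k_ij at y, so that this is the
   vector Gamma(u, v) with components Gamma^k_ij u^i v^j. *)
Definition christoffel Gam y u v : 'rV[R]_n :=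
  \row_k (u *m Gam y k *m v^T) 0 0.

Definition bracket X Y y : 'rV[R]_n := 'D_(X y) Y y - 'D_(Y y) X y.

Definition cov Gam X Y y : 'rV[R]_n :=
  'D_(X y) Y y + christoffel Gam y (X y) (Y y).

(* (nabla_X G)(Y, Z) *)
Definition cov_form Gam G X Y Z y : R :=
  'D_(X y) (fun z => form G z (Y z) (Z z)) y
  - form G y (cov Gam X Y y) (Z y) - form G y (Y y) (cov Gam X Z y).

Definition riemann Gam X Y Z y : 'rV[R]_n :=
  cov Gam X (cov Gam Y Z) y - cov Gam Y (cov Gam X Z) y
  - cov Gam (bracket X Y) Z y.

Definition stat_curv_field Gam Gam' X Y Z y : 'rV[R]_n :=
  2^-1 *: (riemann Gam X Y Z y + riemann Gam' X Y Z y).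

(* S is tensorial: its value on vectors at y is computed on their extensions
   with constant components. *)
Definition stat_curv Gam Gam' y u v w : 'rV[R]_n :=
  stat_curv_field Gam Gam' (cst u) (cst v) (cst w) y.

Definition stat_ricci Gam Gam' y v w : R :=
  \tr (lin1_mx (fun u => stat_curv Gam Gam' y u v w)).

(* The operator L determined by g(L u, w) = L(u, w). *)
Definition stat_ricci_op G Gam Gam' y u : 'rV[R]_n :=
  u *m (\matrix_(j, k) stat_ricci Gam Gam' y (delta_mx 0 j) (delta_mx 0 k))
    *m invmx (G y).

Definition stat_scalar G Gam Gam' y : R :=
  \tr (lin1_mx (stat_ricci_op G Gam Gam' y)).

Definition weyl G Gam Gam' y u v w : 'rV[R]_n :=
  let g := form G y in
  let L := stat_ricci_op G Gam Gam' y in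
  stat_curv Gam Gam' y u v w
  - (n%:R - 2)^-1 *:
      (g v w *: L u - g (L u) w *: v + g (L v) w *: u - g u w *: L v)
  + (stat_scalar G Gam Gam' y / ((n%:R - 2) * (n%:R - 1))) *:
      (g v w *: u - g u w *: v).

(* Meaningful for n = 2m; the coefficients 2m + 4 and 2m + 2 are written
   n + 4 and n + 2. *)
Definition bochner G Gam Gam' (Jm : 'rV[R]_n -> 'M[R]_n) y u v w : 'rV[R]_n :=
  let g := form G y in
  let L := stat_ricci_op G Gam Gam' y in
  let J := fun a : 'rV[R]_n => a *m Jm y in
  stat_curv Gam Gam' y u v w
  - (n%:R + 4)^-1 *:
      (g v w *: L u - g (L u) w *: v + g (L v) w *: u - g u w *: L v
       + g (J v) w *: L (J u) - g (L (J u)) w *: J v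
       + g (L (J v)) w *: J u - g (J u) w *: L (J v)
       - (2 * g (J u) (L v)) *: J w - (2 * g (J u) v) *: L (J w))
  + (stat_scalar G Gam Gam' y / ((n%:R + 4) * (n%:R + 2))) *:
      (g v w *: u - g u w *: v + g (J v) w *: J u - g (J u) w *: J v
       - (2 * g (J u) v) *: J w).

End LocalCalculus.

(* nabla_X (F_* Y) for vector fields X, Y on the source of F, where nabla is
   the connection on the target with Christoffel symbols Gam. *)
Definition cov_along (R : realType) (m n : nat) (F : 'rV[R]_m -> 'rV[R]_n)
    (Gam : 'rV[R]_n -> 'I_n -> 'M[R]_n) (X Y : 'rV[R]_m -> 'rV[R]_m)
    (y : 'rV[R]_m) : 'rV[R]_n :=
  'D_(X y) (fun z => 'd F z (Y z)) y
  + christoffel Gam (F y) ('d F y (X y)) ('d F y (Y y)).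

Section Structures.
Context {R : realType} {n : nat} (M : manifold R n).

Record riemannian_metric := RiemannianMetric {
  gram : chart M -> 'rV[R]_n -> 'M[R]_n;
  gram_smooth : forall i j k, smooth (cimg i) (fun y => gram i y j k : R);
  gram_sym : forall i y, cimg i y -> (gram i y)^T = gram i y;
  gram_posdef : forall i y u, cimg i y -> u != 0 -> 0 < form (gram i) y u u;
  gram_compat : forall i j y u v, overlap i j y ->
    form (gram i) y u v =
    form (gram j) (transition i j y)
      ('d (transition i j) y u) ('d (transition i j) y v)
}.

(* The transformation law says that the differential t_* of a change of
   coordinates satisfies t_*(nabla_X Y) = nabla_(t_* X) (t_* Y). *)
Record connection := Connection {
  gamma : chart M -> 'rV[R]_n -> 'I_n -> 'M[R]_n;
  gamma_smooth : forall i k a b,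
    smooth (cimg i) (fun y => gamma i y k a b : R);
  gamma_compat : forall i j (X Y : 'rV[R]_n -> 'rV[R]_n) y,
    smooth (cimg i) X -> smooth (cimg i) Y -> overlap i j y ->
    'd (transition i j) y (cov (gamma i) X Y y) =
    cov_along (transition i j) (gamma j) X Y y
}.

Record almost_complex := AlmostComplex {
  cplx : chart M -> 'rV[R]_n -> 'M[R]_n;
  cplx_smooth : forall i j k, smooth (cimg i) (fun y => cplx i y j k : R);
  cplx_sqr : forall i y, cimg i y -> cplx i y *m cplx i y = - 1%:M;
  cplx_compat : forall i j y (u : 'rV[R]_n), overlap i j y ->
    'd (transition i j) y (u *m cplx i y) =
    'd (transition i j) y u *m cplx j (transition i j y)
}.

Definition torsion_free (D : connection) : Prop :=
  forall i X Y y, smooth (cimg i) X -> smooth (cimg i) Y -> cimg i y ->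
    cov (gamma D i) X Y y - cov (gamma D i) Y X y = bracket X Y y.

(* Symmetry under two transpositions generating all permutations. *)
Definition cov_metric_symmetric (g : riemannian_metric) (D : connection) :
    Prop :=
  forall i X Y Z y, smooth (cimg i) X -> smooth (cimg i) Y ->
    smooth (cimg i) Z -> cimg i y ->
    cov_form (gamma D i) (gram g i) X Y Z y =
      cov_form (gamma D i) (gram g i) Y X Z y /\
    cov_form (gamma D i) (gram g i) X Y Z y =
      cov_form (gamma D i) (gram g i) X Z Y y.

Definition dual_connections (g : riemannian_metric) (D D' : connection) :
    Prop :=
  forall i X Y Z y, smooth (cimg i) X -> smooth (cimg i) Y ->
    smooth (cimg i) Z -> cimg i y ->
    'D_(X y) (fun z => form (gram g i) z (Y z) (Z z)) y =
    form (gram g i) y (cov (gamma D i) X Y y) (Z y)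
    + form (gram g i) y (Y y) (cov (gamma D' i) X Z y).

(* The dual connection is determined by the other data. *)
Record statistical_structure := StatisticalStructure {
  st_metric : riemannian_metric;
  st_conn : connection;
  st_dual : connection;
  st_torsion_free : torsion_free st_conn;
  st_symmetric : cov_metric_symmetric st_metric st_conn;
  st_duality : dual_connections st_metric st_conn st_dual
}.

(* The Gram matrix of omega(u, v) = g(u, J v). *)
Definition omega (g : riemannian_metric) (J : almost_complex) (i : chart M)
  (y : 'rV[R]_n) : 'M[R]_n := gram g i y *m (cplx J i y)^T.

Definition holomorphic (S : statistical_structure) (J : almost_complex) :
    Prop :=
  (forall i y u v, cimg i y ->
     form (omega (st_metric S) J i) y u v =
     - form (omega (st_metric S) J i) y v u) /\
  (forall i X Y Z y, smooth (cimg i) X -> smooth (cimg i) Y ->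
     smooth (cimg i) Z -> cimg i y ->
     cov_form (gamma (st_conn S) i) (omega (st_metric S) J i) X Y Z y = 0).

Definition bochner_flat (S : statistical_structure) (J : almost_complex) :
    Prop :=
  forall i y u v w, cimg i y ->
    bochner (gram (st_metric S) i) (gamma (st_conn S) i)
      (gamma (st_dual S) i) (cplx J i) y u v w = 0.

Definition conformally_flat (S : statistical_structure) : Prop :=
  forall i y u v w, cimg i y ->
    weyl (gram (st_metric S) i) (gamma (st_conn S) i)
      (gamma (st_dual S) i) y u v w = 0.

End Structures.

Section Submanifolds.
Context {R : realType} {m n : nat} (M : manifold R m) (N : manifold R n).
Variable f : M -> N.

Definition map_dom (i : chart M) (a : chart N) : set 'rV[R]_m :=
  cimg i `&` (f \o cinv i) @^-1` cdom a.

Definition map_rep (i : chart M) (a : chart N) : 'rV[R]_m -> 'rV[R]_n :=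
  cmap a \o f \o cinv i.

Definition smooth_immersion : Prop :=
  continuous f /\
  (forall i a, smooth (map_dom i a) (map_rep i a)) /\
  (forall i a y, map_dom i a y -> injective ('d (map_rep i a) y)).

Definition isometric (g : riemannian_metric M) (gN : riemannian_metric N) :
    Prop :=
  forall i a y u v, map_dom i a y ->
    form (gram g i) y u v =
    form (gram gN a) (map_rep i a y)
      ('d (map_rep i a) y u) ('d (map_rep i a) y v).

(* The part h(X, Y) of the Gauss decomposition left after removing f_* of
   nabla_X Y; it is the second fundamental form once D is induced by DN. *)
Definition second_fundamental (D : connection M) (DN : connection N)
    (i : chart M) (a : chart N) (X Y : 'rV[R]_m -> 'rV[R]_m)
    (y : 'rV[R]_m) : 'rV[R]_n :=
  cov_along (map_rep i a) (gamma DN a) X Y y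
  - 'd (map_rep i a) y (cov (gamma D i) X Y y).

Definition induced_connection (gN : riemannian_metric N)
    (D : connection M) (DN : connection N) : Prop :=
  forall i a X Y y w, smooth (cimg i) X -> smooth (cimg i) Y ->
    map_dom i a y ->
    form (gram gN a) (map_rep i a y)
      (second_fundamental D DN i a X Y y) ('d (map_rep i a) y w) = 0.

Definition statistical_submanifold (S : statistical_structure M)
    (SN : statistical_structure N) : Prop :=
  [/\ smooth_immersion,
      isometric (st_metric S) (st_metric SN),
      induced_connection (st_metric SN) (st_conn S) (st_conn SN) &
      induced_connection (st_metric SN) (st_dual S) (st_dual SN)].

Definition autoparallel (D : connection M) (DN : connection N) : Prop :=
  forall i a X Y y, smooth (cimg i) X -> smooth (cimg i) Y ->
    map_dom i a y -> second_fundamental D DN i a X Y y = 0.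

Definition doubly_autoparallel (S : statistical_structure M)
    (SN : statistical_structure N) : Prop :=
  autoparallel (st_conn S) (st_conn SN) /\
  autoparallel (st_dual S) (st_dual SN).

Definition lagrangian (gN : riemannian_metric N) (J : almost_complex N) :
    Prop :=
  forall i a y (w : 'rV[R]_n), map_dom i a y ->
    (exists u, w = 'd (map_rep i a) y u *m cplx J a (map_rep i a y)) <->
    (forall u, form (gram gN a) (map_rep i a y) w ('d (map_rep i a) y u) = 0).

End Submanifolds.

(* Main.v *)
From Pilot Require Import Defs.
From HB Require Import structures.
From mathcomp Require Import all_boot all_order all_algebra.
From mathcomp Require Import all_classical all_reals all_analysis.
From mathcomp Require Import ring.
Import Pilot.Defs.

Set Implicit Arguments.
Unset Strict Implicit.
Unset Printing Implicit Defensive.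

Import Order.TTheory GRing.Theory Num.Theory.
Import numFieldNormedType.Exports.

Local Open Scope classical_set_scope.
Local Open Scope ring_scope.

(** The theorem rests on one analytic fact and two facts of linear algebra.

    The analytic fact is the Gauss equation without second fundamental form.
    If f carries the connection of M to that of N (which is what h = 0 says),
    then the curvature of M at (u, v, w) is sent by df to the curvature of N at
    (df u, df v, df w) ([autoparallel_riemann]).  In charts, the covariant
    derivatives of both sides are expanded by the chain and product rules
    ([is_derive_christoffel]); the third derivatives of the local
    representative F of f, and the terms with its second derivatives, cancel
    on exchanging u and v because second derivatives commute ([schwarz_row]).
    Applied to both dual connections, since h = h* = 0, this shows that df
    intertwines the statistical curvatures.

    The rest takes place in a single tangent space.  Vanishing of the Bochner
    tensor writes the curvature of N through g, J and the Ricci operator L of N.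
    For tangent vectors of M, g(JX, Y) = 0 by the Lagrangian condition, so after
    orthogonal projection to the tangent space of M every term of the Bochner
    formula that contains J drops out, and what remains is
      S(X, Y)Z = g(Y, Z) AX - g(AX, Z) Y + g(AY, Z) X - g(X, Z) AY
    where A is, up to a multiple of the identity, a multiple of the tangential
    part of L ([lagrangian_bochner_curv]).  Finally, any curvature of this form
    has vanishing Weyl tensor ([weyl_eq0]): taking traces gives
    L_M = tr(A) + (n - 2) A and rho_M = 2 (n - 1) tr(A), so that A is the
    Schouten operator which the Weyl tensor subtracts off. *)

(** * Linear algebra of Weyl and Bochner tensors *)

Section Algebra.
Context {R : realType}.

Lemma formD n (G : 'rV[R]_n -> 'M[R]_n) y u v w :
  form G y (u + v) w = form G y u w + form G y v w.
Proof. by rewrite /form !mulmxDl mxE. Qed.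

Lemma formN n (G : 'rV[R]_n -> 'M[R]_n) y u w :
  form G y (- u) w = - form G y u w.
Proof. by rewrite /form !mulNmx mxE. Qed.

Lemma formZ n (G : 'rV[R]_n -> 'M[R]_n) y a u w :
  form G y (a *: u) w = a * form G y u w.
Proof. by rewrite /form -!scalemxAl mxE. Qed.

Lemma trace_lin1_mx n (f : 'rV[R]_n -> 'rV[R]_n) (K : 'M[R]_n) :
  (forall u, f u = u *m K) -> \tr (lin1_mx f) = \tr K.
Proof.
move=> fK; congr (\tr _); apply/matrixP => i j.
by rewrite mxE fK -rowE mxE.
Qed.

(** Written this way, u |-> g(u, w) v is right multiplication by a matrix,
    whose trace can be taken. *)
Lemma form_scale n (G : 'rV[R]_n -> 'M[R]_n) y u w p (v : 'rV[R]_p) :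
  form G y u w *: v = u *m (G y *m w^T *m v).
Proof. by rewrite /form -mul_scalar_mx -mx11_scalar !mulmxA. Qed.

Lemma delta_mulmx_delta m n (K : 'M[R]_(m, n)) j k :
  ((delta_mx 0 j : 'rV[R]_m) *m K *m (delta_mx 0 k : 'rV[R]_n)^T) 0 0 = K j k.
Proof. by rewrite -rowE trmx_delta -colE !mxE. Qed.

(** Contracting the curvature S(u, v)w with A as below gives Ric = tr(A) g +
    (n - 2) g(A _, _), hence L = tr(A) + (n - 2) A and rho = 2 (n - 1) tr(A).
    Substituting these, the Weyl tensor cancels term by term. *)
Lemma weyl_eq0 n (G : 'rV[R]_n -> 'M[R]_n) Gam Gam' y (A : 'M[R]_n) :
    (2 < n)%N -> G y \in unitmx ->
    (forall u v w, stat_curv Gam Gam' y u v w =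
       form G y v w *: (u *m A) - form G y (u *m A) w *: v
       + form G y (v *m A) w *: u - form G y u w *: (v *m A)) ->
  forall u v w, weyl G Gam Gam' y u v w = 0.
Proof.
move=> n2 unitG SA.
pose t := \tr A.
have ricE v w : stat_ricci Gam Gam' y v w =
    t * form G y v w + (n%:R - 2) * form G y (v *m A) w.
  rewrite /stat_ricci.
  (* the matrix of u |-> S(u, v)w *)
  pose K := form G y v w *: A - A *m (G y *m w^T *m v)
            + (form G y (v *m A) w)%:M - G y *m w^T *m (v *m A).
  rewrite (@trace_lin1_mx _ _ K) => [|u]; last first.
    rewrite SA /K !(mulmxDr, mulmxN) -scalemxAr mul_mx_scalar.
    by rewrite !form_scale !mulmxA.
  rewrite /K !(mxtraceD, raddfN) /= mxtraceZ mxtrace_scalar.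
  have trE (a b : 'rV[R]_n) : \tr (G y *m a^T *m b) = form G y b a.
    by rewrite mxtrace_mulC mulmxA /mxtrace big_ord1.
  rewrite (mxtrace_mulC A) -(mulmxA (G y *m w^T)) !trE -mulr_natr /t.
  ring.
have LE u : stat_ricci_op G Gam Gam' y u = t *: u + (n%:R - 2) *: (u *m A).
  rewrite /stat_ricci_op.
  have -> : \matrix_(j, k) stat_ricci Gam Gam' y (delta_mx 0 j) (delta_mx 0 k)
            = t *: G y + (n%:R - 2) *: (A *m G y).
    apply/matrixP => j k; rewrite !mxE ricE /form -(mulmxA _ A) !delta_mulmx_delta.
    by rewrite [in LHS]mxE.
  rewrite mulmxDr mulmxDl -!scalemxAr -!scalemxAl mulmxA -!mulmxA.
  by rewrite mulmxV // !mulmx1.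
have n20 : n%:R - 2 != 0 :> R by rewrite subr_eq0 eqr_nat gtn_eqF.
have n10 : n%:R - 1 != 0 :> R by rewrite subr_eq0 pnatr_eq1 gtn_eqF // ltnW.
have rhoE : stat_scalar G Gam Gam' y = t * (2 * (n%:R - 1)).
  rewrite /stat_scalar (@trace_lin1_mx _ _ (t%:M + (n%:R - 2) *: A)); last first.
    by move=> u; rewrite LE mulmxDr mul_mx_scalar -scalemxAr.
  by rewrite mxtraceD mxtraceZ mxtrace_scalar -/t -mulr_natr; ring.
move=> u v w; rewrite /weyl rhoE !LE SA !(formD, formZ).
apply/matrixP => i j; rewrite !mxE; field.
by rewrite n20 n10.
Qed.

Lemma posdef_unitmx n (G : 'rV[R]_n -> 'M[R]_n) y :
  (forall u, u != 0 -> 0 < form G y u u) -> G y \in unitmx.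
Proof.
move=> pos; rewrite -row_free_unit; apply: inj_row_free => u uG.
apply/eqP; apply: contraT => /pos.
by rewrite /form uG mul0mx mxE ltxx.
Qed.

(** B is the matrix of the differential of the immersion.  Projecting the
    Bochner formula, taken at three tangent vectors, back to the tangent space
    kills the values of J, which are normal, and the coefficients g(JX, Y) of
    the other J terms.  Of the Ricci operator L of the ambient space only its
    tangential part survives; the scalar curvature term is of the same shape as
    the others, with A a multiple of the identity. *)
Lemma lagrangian_bochner_curv m n
    (G : 'rV[R]_m -> 'M[R]_m) Gam Gam' y
    (GN : 'rV[R]_n -> 'M[R]_n) GamN GamN' Jm x (B : 'M[R]_(m, n)) :
    G y \in unitmx ->
    (forall u v, form G y u v = form GN x (u *m B) (v *m B)) ->
    (forall u v, form GN x (u *m B *m Jm x) (v *m B) = 0) ->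
    (forall u v w, stat_curv Gam Gam' y u v w *m B =
                   stat_curv GamN GamN' x (u *m B) (v *m B) (w *m B)) ->
    (forall u v w, bochner GN GamN GamN' Jm x u v w = 0) ->
  exists A : 'M[R]_m, forall u v w, stat_curv Gam Gam' y u v w =
     form G y v w *: (u *m A) - form G y (u *m A) w *: v
     + form G y (v *m A) w *: u - form G y u w *: (v *m A).
Proof.
move=> unitG isoB lagB curvB flat.
(* orthogonal projection onto the image of B, in the coordinates of the source *)
pose P : 'M[R]_(n, m) := GN x *m B^T *m invmx (G y).
have GE : B *m GN x *m B^T = G y.
  apply/matrixP => i j; have := isoB (delta_mx 0 i) (delta_mx 0 j).
  rewrite /form trmx_mul !mulmxA delta_mulmx_delta => ->.
  by rewrite -[LHS]delta_mulmx_delta !mulmxA.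
have BP : B *m P = 1%:M by rewrite /P !mulmxA GE mulmxV.
have formP z w : form G y (z *m P) w = form GN x z (w *m B).
  by rewrite /form /P trmx_mul !mulmxA mulmxKV.
have JP (u : 'rV[R]_m) : u *m B *m Jm x *m P = 0.
  rewrite /P !mulmxA.
  suff -> : u *m B *m Jm x *m GN x *m B^T = 0 by rewrite mul0mx.
  apply/rowP => k; have := lagB u (delta_mx 0 k).
  by rewrite /form trmx_mul !mulmxA trmx_delta -colE !mxE.
pose L := (\matrix_(j, k) stat_ricci GamN GamN' x (delta_mx 0 j) (delta_mx 0 k))
    *m invmx (GN x).
pose c : R := (n%:R + 4)^-1.
pose d : R := stat_scalar GN GamN GamN' x / ((n%:R + 4) * (n%:R + 2)).
have LE u : stat_ricci_op GN GamN GamN' x u = u *m L.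
  by rewrite /stat_ricci_op mulmxA.
clearbody P L.
(* d / 2, because the identity enters the formula through two pairs of terms *)
exists (c *: (B *m L *m P) - (d / 2)%:M) => u v w.
have SE : stat_curv Gam Gam' y u v w =
    stat_curv GamN GamN' x (u *m B) (v *m B) (w *m B) *m P.
  by rewrite -curvB -mulmxA BP mulmx1.
have := flat (u *m B) (v *m B) (w *m B).
rewrite /bochner !LE !lagB -/c -/d => /(congr1 (mulmx^~ P)).
rewrite mul0mx !mulmxDl -SE !mulNmx -!scalemxAl !mulmxDl !mulNmx -!scalemxAl.
rewrite !JP -!isoB -!formP -![_ *m B *m P]mulmxA BP !mulmx1.
rewrite !mulmxDr !mulmxN -!scalemxAr !mul_mx_scalar !(formD, formN, formZ) !mulmxA.
move: (stat_curv _ _ _ _ _ _) (u *m B *m L *m P) (v *m B *m L *m P) => S a b.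
rewrite !(mulr0, scale0r, scaler0, addr0, subr0) => E.
rewrite -[LHS]subr0 -E; apply/rowP => k.
by rewrite !mxE; field.
Qed.

End Algebra.

(** * Smooth functions on open sets *)

Section Smoothness.
Context {R : realType}.

(** g - f vanishes near x, so that it is differentiable there with differential
    0, and g = f + (g - f). *)
Lemma near_eq_differentiable (V W : normedModType R) (f g : V -> W) x :
  (\near x, f x = g x) -> differentiable f x -> differentiable g x.
Proof.
move=> fg df.
suff dh : differentiable (g - f) x by rewrite -(subrK f g); exact: differentiableD.
have hE : (g - f) \o shift x = cst ((g - f) x) + (\0 : V -> W) +o_ 0 id.
  apply/eqaddoP => _/posnumP[e].
  have /= := fg; rewrite (near_shift 0 x) /= subr0 => fg0.
  near=> y.
  rewrite [X in `|X|](_ : _ = 0) ?normr0 ?mulr_ge0 // !fctE /=.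
  have fgx : f (y + x) = g (y + x) by exact: (near fg0 y).
  by rewrite -fgx -(nbhs_singleton fg) !subrr addr0 subr0.
apply/diff_locallyP.
have d0 := @diff_unique _ _ _ _ \0 x _ hE.
rewrite d0.
  by split=> //; exact: cst_continuous.
exact: cst_continuous.
Unshelve. all: by end_near. Qed.

(** Openness of U matters: the derivatives of f on U only see f near points of
    U.  This is what allows the rules of differentiation, valid on U only, to be
    used under iterated derivatives. *)
Lemma C_k_eq (V W : normedModType R) k (U : set V) (f g : V -> W) :
  open U -> (forall x, U x -> f x = g x) -> C_k k U f -> C_k k U g.
Proof.
move=> oU; elim: k f g => [|k IHk] f g fg /=.
  move=> fc x Ux; have := fc x Ux.
  rewrite /prop_for /continuous_at (fg x Ux); apply: cvg_trans; apply: near_eq_cvg.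
  by apply: filterS (open_nbhs_nbhs (conj oU Ux)) => z /fg ->.
have fgn x : U x -> \near x, f x = g x.
  by move=> Ux; apply: filterS (open_nbhs_nbhs (conj oU Ux)) => z /fg.
move=> [fd fC]; split=> [x Ux|v].
  by apply: near_eq_differentiable (fd x Ux); exact: fgn.
apply: IHk (fC v) => x Ux; apply: near_eq_derive; exact: fgn.
Qed.

Lemma C_kD (V W : normedModType R) k (U : set V) (f g : V -> W) :
  open U -> C_k k U f -> C_k k U g -> C_k k U (f + g).
Proof.
move=> oU; elim: k f g => [|k IHk] f g /=.
  by move=> fc gc x Ux; apply: continuousD; [exact: fc|exact: gc].
move=> [fd fC] [gd gC]; split=> [x Ux|v].
  by apply: differentiableD; [exact: fd|exact: gd].
apply: C_k_eq (IHk _ _ (fC v) (gC v)) => // x Ux.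
by rewrite deriveD //; apply: diff_derivable; [exact: fd|exact: gd].
Qed.

Lemma C_k_linear (V W W' : normedModType R) k (U : set V) (L : {linear W -> W'})
    (f : V -> W) :
  open U -> continuous L -> C_k k U f -> C_k k U (L \o f).
Proof.
move=> oU cL; elim: k f => [|k IHk] f /=.
  by move=> fc x Ux; apply: continuous_comp; [exact: fc|exact: cL].
move=> [fd fC]; split=> [x Ux|v].
  apply: differentiable_comp; [exact: fd|exact: linear_differentiable].
apply: C_k_eq (IHk _ (fC v)) => // x Ux /=.
have dL z : differentiable L z by exact: linear_differentiable.
rewrite !deriveE; [|exact: differentiable_comp (fd x Ux) (dL _)|exact: fd].
rewrite (diff_comp (fd x Ux) (dL _)) /=.
by rewrite diff_lin.
Qed.

Lemma C_k_cst (V W : normedModType R) k (U : set V) (w : W) :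
  C_k k U (cst w).
Proof.
elim: k w => [|k IHk] w /=; first by move=> x _; exact: cst_continuous.
split=> [x _|v]; first exact: differentiable_cst.
by rewrite (_ : 'D_v _ = cst 0) //; apply/funext => x; rewrite derive_cst.
Qed.

Lemma smooth_differentiable (V W : normedModType R) (U : set V) (f : V -> W) x :
  smooth U f -> U x -> differentiable f x.
Proof. by move=> /(_ 1) [fd _]; exact: fd. Qed.

Lemma smooth_derive (V W : normedModType R) (U : set V) (f : V -> W) v :
  smooth U f -> smooth U ('D_v f).
Proof. by move=> sf k; have [_] := sf k.+1; exact. Qed.

Lemma smooth_sum (V W : normedModType R) (U : set V) n (f : 'I_n -> V -> W) :
  open U -> (forall i, smooth U (f i)) ->
  smooth U (fun x => \sum_i f i x).
Proof.
move=> oU sf k.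
have -> : (fun x => \sum_i f i x) = \sum_i f i.
  by apply/funext => x; rewrite fct_sumE.
elim/big_ind: _ => [|g h gC hC|i _]; [exact: C_k_cst|exact: C_kD|exact: sf].
Qed.

Lemma smooth_scalel (V W : normedModType R) (U : set V) (f : V -> R) (w : W) :
  open U -> smooth U f -> smooth U (fun x => f x *: w).
Proof.
move=> oU sf k.
have linL : linear (fun r : R => r *: w).
  by move=> a r s; rewrite scalerDl scalerA.
pose L : {linear R -> W} := HB.pack (fun r : R => r *: w)
  (GRing.isLinear.Build _ _ _ _ _ linL).
have := @C_k_linear _ _ _ k U L f oU; apply=> //; exact: scalel_continuous.
Qed.

Lemma smooth_coord (V : normedModType R) (U : set V) m n
    (f : V -> 'M[R]_(m, n)) i j :
  open U -> smooth U f -> smooth U (fun x => f x i j : R).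
Proof.
move=> oU sf k.
have linL : linear (fun A : 'M[R]_(m, n) => A i j : R).
  by move=> a A B; rewrite !mxE.
pose L : {linear 'M[R]_(m, n) -> R} := HB.pack (fun A : 'M[R]_(m, n) => A i j : R)
  (GRing.isLinear.Build _ _ _ _ _ linL).
have := @C_k_linear _ _ _ k U L f oU; apply=> //; exact: coord_continuous.
Qed.

End Smoothness.

(** * Symmetry of second derivatives *)

Section Schwarz.
Context {R : realType} {V : normedModType R}.
Implicit Types (f : V -> R) (u v x y : V).

Lemma is_derive_line f u x (t : R) : derivable f (t *: u + x) u ->
  is_derive t 1 (fun s : R => f (s *: u + x)) ('D_u f (t *: u + x)).
Proof.
have E : (fun h : R => h^-1 *: (((fun s : R => f (s *: u + x)) \o shift t)
                                  (h *: 1) - f (t *: u + x)))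
       = (fun h : R => h^-1 *: ((f \o shift (t *: u + x)) (h *: u)
                                - f (t *: u + x))).
  apply/funext => h /=; congr (_ *: (f _ - _)).
  by rewrite [h *: 1]mulr1 scalerDl addrA.
move=> df; apply: DeriveDef; first by rewrite /derivable E.
by rewrite /derive E.
Qed.

Definition second_difference f u v y (s : R) : R :=
  f (s *: u + s *: v + y) - f (s *: u + y) - f (s *: v + y) + f y.

Lemma second_differenceC f u v y s :
  second_difference f u v y s = second_difference f v u y s.
Proof. by rewrite /second_difference [s *: u + s *: v]addrC; ring. Qed.

Lemma line_MVT f u x (s : R) : 0 < s ->
    (forall t, 0 <= t <= s -> derivable f (t *: u + x) u) ->
  exists2 t, 0 <= t <= s & f (s *: u + x) - f x = s * 'D_u f (t *: u + x).
Proof.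
move=> s0 df.
have [t|t|t ts] := @MVT _ (fun t : R => f (t *: u + x))
  (fun t => 'D_u f (t *: u + x)) 0 s s0.
- rewrite in_itv /= => /andP[t0 ts]; apply: is_derive_line; apply: df.
  by apply/andP; split; apply: ltW.
- apply: derivable_within_continuous => r; rewrite in_itv /= => rs.
  by have [] := is_derive_line (df r rs).
- rewrite scale0r add0r subr0 mulrC => E; exists t => //.
  by move: ts; rewrite in_itv /= => /andP[t0 ts]; apply/andP; split; apply: ltW.
Qed.

(** The mean value theorem is applied along u to z |-> f (z + s v) - f z, and
    then along v to the difference of the values of D_u f that results. *)
Lemma second_difference_MVT f u v y (s : R) : 0 < s ->
    (forall a b, 0 <= a <= s -> 0 <= b <= s ->
       derivable f (a *: u + b *: v + y) u /\
       derivable ('D_u f) (a *: u + b *: v + y) v) ->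
  exists a b, [/\ 0 <= a <= s, 0 <= b <= s &
    second_difference f u v y s =
      s ^+ 2 * 'D_v ('D_u f) (a *: u + b *: v + y)].
Proof.
move=> s0 df.
have s00 : 0 <= (0 : R) <= s by rewrite lexx ltW.
have ss : 0 <= s <= s by rewrite lexx ltW.
pose h z := f (z + s *: v) - f z.
have dh t : 0 <= t <= s -> is_derive (t *: u + y) u h
    ('D_u f (t *: u + s *: v + y) - 'D_u f (t *: u + y)).
  move=> ts; have [d1 _] := df t s ts ss; have [d2 _] := df t 0 ts s00.
  rewrite scale0r addr0 in d2.
  have d3 : is_derive (t *: u + y) u (fun z => f (z + s *: v))
     ('D_u f (t *: u + s *: v + y)).
    have E : (fun r : R => r^-1 *: (((fun z => f (z + s *: v))
          \o shift (t *: u + y)) (r *: u) - f (t *: u + y + s *: v)))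
        = (fun r : R => r^-1 *: ((f \o shift (t *: u + s *: v + y)) (r *: u)
          - f (t *: u + s *: v + y))).
      by apply/funext => r /=; rewrite -!addrA (addrC y).
    by split; rewrite /derivable /derive E.
  exact: is_deriveB.
have [a aI Ea] := @line_MVT h u y s s0 (fun t ts => @ex_derive _ _ _ _ _ _ _ (dh t ts)).
have [b bI Eb] := @line_MVT ('D_u f) v (a *: u + y) s s0
  (fun t ts => ltac:(rewrite addrA (addrC _ (a *: u)); exact: (df a t aI ts).2)).
exists a, b; split; [exact: aI|exact: bI|].
have Da : 'D_u h (a *: u + y) = _ := @derive_val _ _ _ _ _ _ _ (dh a aI).
move: Ea Eb; rewrite Da !addrA ![_ *: v + a *: u]addrC => Ea Eb.
rewrite expr2 -mulrA -Eb -Ea /h /second_difference.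
by rewrite (addrAC (s *: u)) (addrC y); ring.
Qed.

Lemma close_of_common_value (p q p' q' e : R) :
  `|p - p'| < e / 2 -> `|q - q'| < e / 2 -> p' = q' -> `|p - q| <= e.
Proof.
move=> pp qq E; rewrite -E in qq.
have -> : p - q = (p - p') - (q - p') by ring.
by apply: (le_trans (ler_normB _ _)); rewrite [e]splitr lerD // ltW.
Qed.

(** The second difference of f is s^2 times a value near y of D_v D_u f and, by
    symmetry in u and v, s^2 times a value near y of D_u D_v f; both second
    derivatives are continuous at y, so they agree there. *)
Lemma schwarz (U : set V) f u v y :
  open U -> smooth U f -> U y -> 'D_u ('D_v f) y = 'D_v ('D_u f) y.
Proof.
move=> oU sf Uy; apply/eqP; rewrite -subr_eq0 -normr_le0.
apply/ler_addgt0Pl => e e0; rewrite addr0.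
have cont a b : \forall z \near y, `|'D_a ('D_b f) y - 'D_a ('D_b f) z| < e / 2.
  have c := smooth_derive a (smooth_derive b sf) 0%N y Uy.
  by have /cvgrPdist_lt := c; apply; rewrite divr_gt0.
have nU := open_nbhs_nbhs (conj oU Uy).
have [r /= r0 rP] := (nbhs_normP _ _).1 (filterI nU (filterI (cont u v) (cont v u))).
pose k := 1 + `|u| + `|v|.
have k0 : 0 < k by rewrite /k -addrA ltr_pwDl // addr_ge0.
(* small enough for the parallelogram spanned by s u and s v at y to lie in
   the ball of radius r *)
pose s := r / k.
have s0 : 0 < s by rewrite divr_gt0.
have near_y a b : 0 <= a <= s -> 0 <= b <= s ->
    (U `&` [set z | `|'D_u ('D_v f) y - 'D_u ('D_v f) z| < e / 2] `&`
     [set z | `|'D_v ('D_u f) y - 'D_v ('D_u f) z| < e / 2])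
    (a *: u + b *: v + y).
  move=> /andP[a0 as_] /andP[b0 bs]; rewrite -setIA; apply: rP => /=.
  rewrite opprD addrA addrAC subrr sub0r normrN.
  apply: (le_lt_trans (ler_normD _ _)); rewrite !normrZ !ger0_norm //.
  apply: (@le_lt_trans _ _ (s * (`|u| + `|v|))).
    by rewrite mulrDr lerD // ler_wpM2r.
  by rewrite mulrAC ltr_pdivrMr // ltr_pM2l // /k -addrA ltrDr.
have dd a b g : smooth U g -> U a -> derivable g a b.
  by move=> sg Ua; apply/diff_derivable/(smooth_differentiable sg Ua).
have [|a [b [aI bI E1]]] := @second_difference_MVT f u v y s s0.
  move=> a b aI bI; have [[Uz _] _] := near_y a b aI bI.
  by split; apply: dd => //; exact: smooth_derive.
have [|a' [b' [aI' bI' E2]]] := @second_difference_MVT f v u y s s0.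
  move=> a' b' aI' bI'; rewrite (addrC (a' *: v)).
  have [[Uz _] _] := near_y b' a' bI' aI'.
  by split; apply: dd => //; exact: smooth_derive.
have [[_ _] /= H1] := near_y a b aI bI.
have [[_ /= H2] _] := near_y b' a' bI' aI'.
move: E1; rewrite second_differenceC E2 (addrC (a' *: v)).
have s20 : s ^+ 2 != 0 by rewrite expf_neq0 // gt_eqF.
move=> /(mulfI s20) E.
exact: close_of_common_value H2 H1 E.
Qed.

End Schwarz.

Lemma schwarz_row (R : realType) (V : normedModType R) n (U : set V)
    (F : V -> 'rV[R]_n) u v y :
  open U -> smooth U F -> U y -> 'D_u ('D_v F) y = 'D_v ('D_u F) y.
Proof.
move=> oU sF Uy.
have dd (G : V -> 'rV[R]_n) a z : smooth U G -> U z -> derivable G z a.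
  by move=> sG Uz; apply/diff_derivable/(smooth_differentiable sG Uz).
have coordD a b k : ('D_a ('D_b F) y) 0 k = 'D_a ('D_b (fun z => F z 0 k)) y.
  rewrite derive_mx; last by apply: dd Uy; exact: smooth_derive.
  rewrite mxE; apply: near_eq_derive.
  apply: filterS (open_nbhs_nbhs (conj oU Uy)) => z Uz.
  by rewrite derive_mx ?mxE //; exact: dd.
have sFk k : smooth U (fun z => F z 0 k : R) by exact: smooth_coord.
apply/rowP => k.
exact: etrans (coordD u v k) (etrans (schwarz u v oU (sFk k) Uy)
                                     (esym (coordD v u k))).
Qed.

(** * Derivatives of Christoffel symbols *)

Section Christoffel.
Context {R : realType}.

Lemma is_derive_coord (V : normedModType R) n (f : V -> 'rV[R]_n) x h k :
  derivable f x h -> is_derive x h (fun z => f z 0 k : R) ('D_h f x 0 k).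
Proof.
move=> df; split; first by have /derivable_mxP := df; exact.
by have /rowP/(_ k) := derive_mx df; rewrite [RHS]mxE => ->.
Qed.

Lemma is_derive_row (V : normedModType R) n (f : V -> 'rV[R]_n) x h (d : 'rV[R]_n) :
  (forall k, is_derive x h (fun z => f z 0 k : R) (d 0 k)) -> is_derive x h f d.
Proof.
move=> df; have f_drv : derivable f x h.
  by apply/derivable_mxP => i k; rewrite ord1; have [] := df k.
split=> //; rewrite derive_mx //; apply/rowP => k.
by rewrite mxE; exact: (@derive_val _ _ _ _ _ _ _ (df k)).
Qed.

Variable n : nat.
Implicit Types (Gam : 'rV[R]_n -> 'I_n -> 'M[R]_n) (u v w y : 'rV[R]_n).

Lemma christoffelE Gam y u v k :
  christoffel Gam y u v 0 k = \sum_i \sum_j (u 0 i * Gam y k i j * v 0 j).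
Proof.
rewrite /christoffel !mxE exchange_big /=; apply: eq_bigr => j _.
by rewrite !mxE big_distrl.
Qed.

Lemma christoffelDl Gam y u v w :
  christoffel Gam y (u + v) w = christoffel Gam y u w + christoffel Gam y v w.
Proof.
apply/rowP => k; rewrite [RHS]mxE !christoffelE -big_split; apply: eq_bigr => i _.
by rewrite -big_split; apply: eq_bigr => j _; rewrite mxE !mulrDl.
Qed.

Lemma christoffelDr Gam y u v w :
  christoffel Gam y u (v + w) = christoffel Gam y u v + christoffel Gam y u w.
Proof.
apply/rowP => k; rewrite [RHS]mxE !christoffelE -big_split; apply: eq_bigr => i _.
by rewrite -big_split; apply: eq_bigr => j _; rewrite mxE mulrDr.
Qed.

Lemma christoffel0l Gam y v : christoffel Gam y 0 v = 0.
Proof.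
apply/rowP => k; rewrite christoffelE [RHS]mxE big1 // => i _.
by rewrite big1 // => j _; rewrite mxE !mul0r.
Qed.

Lemma smooth_christoffel (U : set 'rV[R]_n) Gam u v : open U ->
    (forall k i j, smooth U (fun y => Gam y k i j : R)) ->
  smooth U (fun y => christoffel Gam y u v).
Proof.
move=> oU sG.
have -> : (fun y => christoffel Gam y u v) =
    fun y => \sum_k \sum_i \sum_j Gam y k i j *: ((u 0 i * v 0 j) *: delta_mx 0 k).
  apply/funext => y; rewrite [LHS]row_sum_delta; apply: eq_bigr => k _.
  rewrite christoffelE scaler_suml; apply: eq_bigr => i _.
  rewrite scaler_suml; apply: eq_bigr => j _.
  by rewrite scalerA mulrA (mulrC (u 0 i)).
apply: smooth_sum => // k; apply: smooth_sum => // i; apply: smooth_sum => // j.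
exact: smooth_scalel.
Qed.

(** Gamma(a, b) is linear in each of Gamma, a and b, which gives a product rule
    with three terms; the first is the derivative of Gamma along the velocity of
    p, by the chain rule. *)
Lemma is_derive_christoffel (V : normedModType R) Gam
    (p a b : V -> 'rV[R]_n) (x h : V) :
    differentiable p x -> derivable a x h -> derivable b x h ->
    (forall k i j, differentiable (fun y => Gam y k i j : R) (p x)) ->
  is_derive x h (fun z => christoffel Gam (p z) (a z) (b z))
    ('D_('D_h p x) (fun y => christoffel Gam y (a x) (b x)) (p x)
     + christoffel Gam (p x) ('D_h a x) (b x)
     + christoffel Gam (p x) (a x) ('D_h b x)).
Proof.
move=> dp da db dG.
have dai i := is_derive_coord i da; have dbi i := is_derive_coord i db.
have dGp k i j : is_derive x h (fun z => Gam (p z) k i j : R)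
    ('D_('D_h p x) (fun y => Gam y k i j : R) (p x)).
  have dc : differentiable ((fun y => Gam y k i j : R) \o p) x.
    exact: differentiable_comp.
  split; first exact: diff_derivable.
  rewrite (deriveE _ dp) (deriveE _ (dG k i j)).
  by rewrite [LHS](deriveE _ dc) (diff_comp dp (dG k i j)).
pose dG' k i j : R := 'D_('D_h p x) (fun y => Gam y k i j : R) (p x).
pose D := \row_k (\sum_i \sum_j a x 0 i * dG' k i j * b x 0 j).
have -> : 'D_('D_h p x) (fun y => christoffel Gam y (a x) (b x)) (p x) = D.
  apply: (@derive_val _ _ _ _ _ _ _ (is_derive_row _)) => k.
  have -> : (fun y => christoffel Gam y (a x) (b x) 0 k : R) =
      \sum_i \sum_j (fun y => a x 0 i * Gam y k i j * b x 0 j : R).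
    apply/funext => y; rewrite christoffelE fct_sumE; apply: eq_bigr => i _.
    by rewrite fct_sumE.
  rewrite mxE; apply: is_derive_sum => i; apply: is_derive_sum => j.
  have dGd := derivableP (diff_derivable (v := 'D_h p x) (dG k i j)).
  have := is_deriveM (is_deriveM (is_derive_cst (a x 0 i : R) _ _) dGd)
    (is_derive_cst (b x 0 j : R) _ _).
  move=> D1; apply: (is_derive_eq D1).
  by rewrite !scaler0 addr0 add0r /GRing.scale /= mulrC.
apply: is_derive_row => k.
have -> : (fun z => christoffel Gam (p z) (a z) (b z) 0 k : R) =
    \sum_i \sum_j (fun z => a z 0 i * Gam (p z) k i j * b z 0 j : R).
  apply/funext => y; rewrite christoffelE fct_sumE; apply: eq_bigr => i _.
  by rewrite fct_sumE.
rewrite mxE [X in X + _]mxE [X in X + _ + _]mxE !christoffelE -!big_split /=.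
apply: is_derive_sum => i; rewrite -!big_split /=.
apply: is_derive_sum => j.
have := is_deriveM (is_deriveM (dai i) (dGp k i j)) (dbi j).
move=> D1; apply: (is_derive_eq D1); rewrite !fctE /GRing.scale /= /dG'.
ring.
Qed.

End Christoffel.

(** * Curvature and maps that preserve connections *)

Section Curvature.
Context {R : realType}.

Lemma cov_cst n Gam (u v : 'rV[R]_n) :
  cov Gam (cst u) (cst v) = fun y => christoffel Gam y u v.
Proof. by apply/funext => y; rewrite /cov derive_cst add0r. Qed.

Lemma riemann_cst n Gam y (u v w : 'rV[R]_n) :
  riemann Gam (cst u) (cst v) (cst w) y =
  cov Gam (cst u) (fun z => christoffel Gam z v w) y
  - cov Gam (cst v) (fun z => christoffel Gam z u w) y.
Proof.
rewrite /riemann !cov_cst [X in _ - X](_ : _ = 0) ?subr0 //.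
by rewrite /cov /bracket !derive_cst subrr christoffel0l addr0.
Qed.

(** D is the open set on which the vector fields and the connection Gam live, U
    the possibly smaller one on which the map F to another chart is defined. *)
Definition preserves_connection m n (D U : set 'rV[R]_m) (F : 'rV[R]_m -> 'rV[R]_n)
    Gam GamN :=
  forall X Y z, smooth D X -> smooth D Y -> U z ->
    cov_along F GamN X Y z = 'd F z (cov Gam X Y z).

(** In the use below, s is the third derivative of F, symmetric in the two
    exchanged directions; a is the Christoffel symbol applied to the second
    derivative in those two directions; b and c come once from the product rule
    and once from the linearity of the outer Christoffel symbol, with opposite
    signs. *)
Lemma gauss_cancellation n (s s' p q a a' b c t t' bt' ct : 'rV[R]_n) :
    s = s' -> a = a' -> ct = c + t -> bt' = b + t' ->
  s + (p + a + b) + ct - (s' + (q + a' + c) + bt') = (p + t) - (q + t').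
Proof. by move=> -> -> -> ->; apply/rowP => k; rewrite !mxE; ring. Qed.

(** Vector fields along F are expressed through the derivatives D_a F, so that
    the image of nabla_b c becomes D_b D_c F + Gamma(D_b F, D_c F) ([geo1]).
    Differentiating once more ([geo2]) and antisymmetrizing leaves exactly the
    curvature of the target on constant fields. *)
Lemma preserves_connection_riemann m n (D U : set 'rV[R]_m)
    (F : 'rV[R]_m -> 'rV[R]_n) (Gam : 'rV[R]_m -> 'I_m -> 'M[R]_m)
    (GamN : 'rV[R]_n -> 'I_n -> 'M[R]_n) y (u v w : 'rV[R]_m) :
    open D -> open U -> smooth U F -> U y ->
    (forall k i j, smooth D (fun z => Gam z k i j : R)) ->
    (forall k i j, differentiable (fun q => GamN q k i j : R) (F y)) ->
    preserves_connection D U F Gam GamN ->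
  'd F y (riemann Gam (cst u) (cst v) (cst w) y) =
  riemann GamN (cst ('d F y u)) (cst ('d F y v)) (cst ('d F y w)) (F y).
Proof.
move=> oD oU sF Uy sGam dGamN geo.
have dd (f : 'rV[R]_m -> 'rV[R]_n) z : smooth U f -> U z -> differentiable f z.
  exact: smooth_differentiable.
have nearU z : U z -> nbhs z U by move=> Uz; apply: open_nbhs_nbhs.
have dFE a z : U z -> 'd F z a = 'D_a F z.
  by move=> Uz; rewrite deriveE //; exact: dd.
have sD a : smooth U ('D_a F) by exact: smooth_derive.
have sDD a b : smooth U ('D_a ('D_b F)) by exact: smooth_derive.
pose T a b z := christoffel GamN (F z) ('D_a F z) ('D_b F z).
have geo1 a b z : U z -> 'd F z (christoffel Gam z a b) = 'D_a ('D_b F) z + T a b z.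
  move=> Uz; have := @geo (cst a) (cst b) z (fun k => C_k_cst k D a)
    (fun k => C_k_cst k D b) Uz.
  rewrite cov_cst => <-; rewrite /cov_along /T -!dFE //; congr (_ + _).
  by apply: near_eq_derive; apply: filterS (nearU z Uz) => z' /(dFE b).
pose P a b c := 'D_('D_a F y) (fun q => christoffel GamN q ('D_b F y) ('D_c F y)) (F y).
have dT a b c : is_derive y a (T b c) (P a b c
    + christoffel GamN (F y) ('D_a ('D_b F) y) ('D_c F y)
    + christoffel GamN (F y) ('D_b F y) ('D_a ('D_c F) y)).
  apply: is_derive_christoffel; [exact: dd| | |exact: dGamN];
  by apply: diff_derivable; exact: dd.
have geo2 a b c : 'd F y (cov Gam (cst a) (fun z => christoffel Gam z b c) y) =
    'D_a ('D_b ('D_c F)) y + (P a b c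
    + christoffel GamN (F y) ('D_a ('D_b F) y) ('D_c F y)
    + christoffel GamN (F y) ('D_b F y) ('D_a ('D_c F) y))
    + christoffel GamN (F y) ('D_a F y) ('D_b ('D_c F) y + T b c y).
  pose W z := christoffel Gam z b c.
  have sW : smooth D W by exact: smooth_christoffel.
  rewrite -/W -(geo _ _ _ (fun k => C_k_cst k D a) sW Uy).
  have -> : cov_along F GamN (cst a) W y = 'D_a (fun z => 'd F z (W z)) y
      + christoffel GamN (F y) ('D_a F y) ('d F y (W y)).
    by rewrite -(dFE a y Uy).
  have geoW z : U z -> 'd F z (W z) = 'D_b ('D_c F) z + T b c z.
    exact: (geo1 b c z).
  congr (_ + _); last by congr christoffel; exact: geoW.
  have [dTd dTE] := dT a b c.
  rewrite -dTE.
  transitivity ('D_a ('D_b ('D_c F) + T b c) y).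
    by apply: near_eq_derive; apply: filterS (nearU y Uy) => z /geoW.
  have dDD : derivable ('D_b ('D_c F)) y a by apply: diff_derivable; exact: dd.
  exact: (deriveD dDD dTd).
have s2 : christoffel GamN (F y) ('D_u ('D_v F) y) ('D_w F y) =
    christoffel GamN (F y) ('D_v ('D_u F) y) ('D_w F y).
  exact: (congr1 (fun z => christoffel GamN (F y) z ('D_w F y))
                 (schwarz_row u v oU sF Uy)).
rewrite !riemann_cst raddfB /= !geo2 !(dFE _ y Uy) /cov.
have c1 := christoffelDr GamN (F y) ('D_u F y) ('D_v ('D_w F) y) (T v w y).
have c2 := christoffelDr GamN (F y) ('D_v F y) ('D_u ('D_w F) y) (T u w y).
refine (@gauss_cancellation _ _ _ (P u v w) (P v u w) _ _ _ _ _ _ _ _ _ s2 c1 c2).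
exact: schwarz_row oU (sD w) Uy.
Qed.

End Curvature.

(** * Doubly autoparallel submanifolds *)

Section Submanifold.
Context {R : realType}.

Lemma open_map_dom m n (M : manifold R m) (N : manifold R n) (f : M -> N) i a :
  continuous f -> open (map_dom f i a).
Proof.
move=> cf; rewrite openE => z [Uz /= az]; apply: filterI.
  by apply: open_nbhs_nbhs; split; [exact: cimg_open|exact: Uz].
have nb : nbhs (f (cinv i z)) (cdom a).
  exact: open_nbhs_nbhs (conj (cdom_open a) az).
exact: continuous_comp (cinv_continuous Uz) (cf _) _ nb.
Qed.

Lemma autoparallel_preserves_connection m n (M : manifold R m) (N : manifold R n)
    (f : M -> N) (D : connection M) (DN : connection N) i a :
  autoparallel f D DN ->
  preserves_connection (cimg i) (map_dom f i a) (map_rep f i a) (gamma D i) (gamma DN a).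
Proof. by move=> auto_f X Y z sX sY Uz; apply/subr0_eq/auto_f. Qed.

(** This is the Gauss equation for a vanishing second fundamental form; it holds
    separately for each connection of a dual pair. *)
Lemma autoparallel_riemann m n (M : manifold R m) (N : manifold R n)
    (f : M -> N) (D : connection M) (DN : connection N) i a y u v w :
    smooth_immersion f -> autoparallel f D DN -> map_dom f i a y ->
  'd (map_rep f i a) y (riemann (gamma D i) (cst u) (cst v) (cst w) y) =
  riemann (gamma DN a) (cst ('d (map_rep f i a) y u))
    (cst ('d (map_rep f i a) y v)) (cst ('d (map_rep f i a) y w)) (map_rep f i a y).
Proof.
move=> [cf [sf _]] auto_f Uy.
apply: (@preserves_connection_riemann _ _ _ (cimg i) (map_dom f i a)) => //.
- exact: cimg_open.
- exact: open_map_dom.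
- by move=> k j l; exact: gamma_smooth.
- move=> k j l; apply: smooth_differentiable (gamma_smooth DN a k j l) _.
  by case: Uy => _ /= az; exists (f (cinv i y)).
- exact: autoparallel_preserves_connection.
Qed.

End Submanifold.

Theorem theorem1p1 (R : realType) (m : nat) (hm : (4 <= m)%N)
    (N : manifold R (2 * m)) (SN : statistical_structure N)
    (J : almost_complex N) (holN : holomorphic SN J)
    (flatN : bochner_flat SN J)
    (M : manifold R m) (S : statistical_structure M) (f : M -> N)
    (subM : statistical_submanifold f S SN)
    (lagM : lagrangian f (st_metric SN) J)
    (autoM : doubly_autoparallel f S SN) :
  conformally_flat S.
Proof.
move=> i y u v w Uy.
have [immf isof _ _] := subM; have [autoD autoD'] := autoM.
have [a ay] := cdom_cover (f (cinv i y)).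
have Uay : map_dom f i a y by [].
have img : cimg a (map_rep f i a y) by exists (f (cinv i y)).
pose B := lin1_mx ('d (map_rep f i a) y).
have BE z : 'd (map_rep f i a) y z = z *m B by rewrite mul_rV_lin1.
have unitG : gram (st_metric S) i y \in unitmx.
  by apply: posdef_unitmx => z; exact: gram_posdef.
have [||||A SA] := @lagrangian_bochner_curv _ _ _
  (gram (st_metric S) i) (gamma (st_conn S) i)
  (gamma (st_dual S) i) y (gram (st_metric SN) a) (gamma (st_conn SN) a)
  (gamma (st_dual SN) a) (cplx J a) (map_rep f i a y) B unitG.
- by move=> u' v'; rewrite -!BE; exact: isof.
- move=> u' v'; rewrite -!BE; apply: (lagM i a y _ Uay).1.
  by exists u'.
- move=> u' v' w'; rewrite -!BE /stat_curv /stat_curv_field linearZ linearD /=.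
  by rewrite (autoparallel_riemann u' v' w' immf autoD Uay)
             (autoparallel_riemann u' v' w' immf autoD' Uay).
- by move=> u' v' w'; exact: flatN.
by apply: (weyl_eq0 _ unitG SA); exact: ltn_trans hm.
Qed.
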